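(* Let $(a_n),(b_n)$ be sequences of non-negative reals with $a_n=O(1)$, $b_n=O(1)$, and suppose the edge probabilities are $p_n=a_n\,n^{-1}\log n\in[0,1]$ and $q_n=b_n\,n^{-1}\log n\in[0,1]$ (Chernoff-Hellinger phase). For every $n\ge1$ let $\theta_n\in\Theta_n$, $X^n\sim P_{\theta_n}$, and choose the uniform prior on $\Theta_n$. If $$\Bigl(\bigl(\sqrt{a_n}-\sqrt{b_n}\bigr)^2-\frac{a_nb_n\log(n)}{2n}-4\Bigr)\log(n)\to\infty\qquad(n\to\infty),$$ then the posterior recovers the community assignments exactly, i.e. $P_{\theta_n}\Pi(\{\theta_n\}\mid X^n)\to1$ as $n\to\infty$.
   Context: Stochastic block model with two communities: for $n\ge1$ and $0\le m\le\lfloor n/2\rfloor$ let $\Theta_{n,m}=\{\theta_n\in\{0,1\}^n:\sum_i\theta_{n,i}=m\}$, except that for even $n$ and $m=n/2$, $\Theta_{n,n/2}=\{\theta_n\in\{0,1\}^n:\sum_i\theta_{n,i}=n/2,\ \theta_{n,1}=0\}$. Let $\Theta_n=\bigcup_{m=0}^{\lfloor n/2\rfloor}\Theta_{n,m}$; it has $2^{n-1}$ elements. Let $p_n,q_n\in[0,1]$. Under $P_{\theta_n}$ the observed random graph $X^n=\{X_{ij}:1\le i<j\le n\}\in\mathscr{X}_n=\{0,1\}^{\{(i,j):1\le i<j\le n\}}$ has independent edges with $P_{\theta_n}(X_{ij}=1)=Q_{ij}(\theta_n)$, where $Q_{ij}(\theta_n)=p_n$ if $\theta_{n,i}=\theta_{n,j}$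 and $Q_{ij}(\theta_n)=q_n$ if $\theta_{n,i}\ne\theta_{n,j}$. Its probability mass function is $p_{\theta_n}(x^n)=\prod_{i<j}Q_{ij}(\theta_n)^{x_{ij}}(1-Q_{ij}(\theta_n))^{1-x_{ij}}$ (with $0^0=1$). The uniform prior gives mass $2^{-(n-1)}$ to each element of $\Theta_n$; the corresponding posterior is $\Pi(A\mid X^n)=\sum_{\theta\in A}p_{\theta}(X^n)\big/\sum_{\theta'\in\Theta_n}p_{\theta'}(X^n)$ for $A\subset\Theta_n$ (defined whenever the denominator is positive, which holds $P_{\theta_n}$-almost surely for each $\theta_n\in\Theta_n$). $P_{\theta_n}f(X^n)$ denotes the expectation of $f(X^n)$ under $P_{\theta_n}$. *)

(* Defs.v *)
From HB Require Import structures.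
From mathcomp Require Import all_boot all_order all_algebra.
From mathcomp Require Import all_classical all_reals all_analysis.

Set Implicit Arguments.
Unset Strict Implicit.
Unset Printing Implicit Defensive.
Import Order.TTheory GRing.Theory Num.Theory.
Import numFieldNormedType.Exports.
Local Open Scope ring_scope.

(** The coordinates [1, ..., n] of the text are [0, ..., n - 1] in ['I_n], so
    the normalisation [theta_{n,1} = 0] for [m = n/2] concerns the index 0. *)
Definition Theta_size (n m : nat) : {set {ffun 'I_n -> bool}} :=
  [set theta : {ffun 'I_n -> bool} |
    ((\sum_(i < n) nat_of_bool (theta i))%N == m) &&
    ((~~ odd n && (m == n./2)) ==>
       [forall i : 'I_n, (nat_of_ord i == 0%N) ==> ~~ theta i])].

Definition Theta (n : nat) : {set {ffun 'I_n -> bool}} :=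
  (\bigcup_(m < n./2.+1) Theta_size n m)%SET.

Definition vpair (n : nat) : finType := {e : 'I_n * 'I_n | (e.1 < e.2)%N}.

Definition graph (n : nat) : finType := {ffun vpair n -> bool}.

Definition edge_prob (R : realType) (n : nat) (p q : R)
    (theta : {ffun 'I_n -> bool}) (e : vpair n) : R :=
  if theta (val e).1 == theta (val e).2 then p else q.

Definition sbm_pmf (R : realType) (n : nat) (p q : R)
    (theta : {ffun 'I_n -> bool}) (x : graph n) : R :=
  \prod_(e : vpair n)
    (edge_prob p q theta e ^+ nat_of_bool (x e) *
     (1 - edge_prob p q theta e) ^+ (1 - nat_of_bool (x e))%N).

Definition sbm_expectation (R : realType) (n : nat) (p q : R)
    (theta : {ffun 'I_n -> bool}) (f : graph n -> R) : R :=
  \sum_(x : graph n) sbm_pmf p q theta x * f x.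

(** Posterior mass of [A], a subset of [Theta n], under the uniform prior on
    [Theta n]; the prior weights cancel.  Where the denominator vanishes the
    value is 0 by the convention for division; this has no effect on
    expectations under parameters in [Theta n], whose mass function is 0 at
    such graphs. *)
Definition posterior (R : realType) (n : nat) (p q : R)
    (A : {set {ffun 'I_n -> bool}}) (x : graph n) : R :=
  (\sum_(theta in A) sbm_pmf p q theta x) /
  (\sum_(theta in Theta n) sbm_pmf p q theta x).

(* Main.v *)
Require Import Defs.
From HB Require Import structures.
From mathcomp Require Import all_boot all_order all_algebra.
From mathcomp Require Import all_classical all_reals all_analysis.
From mathcomp Require Import zify ring lra.

(** The expected posterior mass of the wrong labellings is controlled by a
    union bound over pairwise comparisons.  For one wrong labelling [eta], the
    expected posterior mass of [eta] under [theta] is at most the Hellinger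
    overlap [\sum_x sqrt (p_theta x * p_eta x)] ([posterior_error_le]).  Edges
    are independent, so this overlap is a product over pairs of vertices; a
    pair contributes the factor 1, unless [theta] and [eta] disagree on whether
    it lies inside one community, and then it contributes the Bernoulli
    affinity [r = sqrt (p q) + sqrt ((1 - p) (1 - q))] ([sum_sqrt_sbm_pmf]).  If
    the labellings differ at [k] vertices there are exactly [k (n - k)] such
    pairs ([card_separated]), so the error is at most the sum of
    [r ^ (k (n - k))] over the wrong labellings.

    The phase condition says that [r <= 1 - (4 ln n + t) / (2 n)] with [t]
    tending to infinity, whence [r ^ n <= z ^ 2] for [z = exp (- t / 4) / n]
    ([affinity_pow_le]).  The larger of [k] and [n - k] is at least [n / 2],
    so [r ^ (k (n - k)) <= z ^ k + z ^ (n - k)] ([pow_le_pow_add]).  Here [k] and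
    [n - k] are the distances of [eta] to [theta] and to the complement of
    [theta], neither of which is a wrong labelling: the complement gives the
    same graph law, but [Theta n] keeps only one labelling out of each
    complementary pair ([complement_notin_Theta]).  The sum of
    [z ^ hamming theta eta] over all [eta] is [(1 + z) ^ n], and the centre
    itself accounts for the term 1; so each of the two sums is at most
    [(1 + z) ^ n - 1 <= exp (n z) - 1 = exp (exp (- t / 4)) - 1], which tends
    to 0. *)

Import Order.TTheory GRing.Theory Num.Theory.
Import numFieldNormedType.Exports.
Local Open Scope classical_set_scope.
Local Open Scope ring_scope.

(** * Likelihoods and their overlap *)

Definition affinity {R : realType} (p q : R) : R :=
  Num.sqrt (p * q) + Num.sqrt ((1 - p) * (1 - q)).

Lemma sum_ffun_bool_prod {R : realType} {I : finType} (F : I -> bool -> R) :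
  \sum_(x : {ffun I -> bool}) \prod_i F i (x i)
  = \prod_i (F i true + F i false).
Proof.
rewrite -bigA_distr_bigA; apply: eq_bigr => i _.
by rewrite big_bool.
Qed.

Lemma sqrt_prod {R : realType} {I : finType} (F : I -> R) :
  (forall i, 0 <= F i) ->
  Num.sqrt (\prod_i F i) = \prod_i Num.sqrt (F i).
Proof.
move=> F_ge0.
suff [] : Num.sqrt (\prod_i F i) = \prod_i Num.sqrt (F i) /\ 0 <= \prod_i F i by [].
elim/big_rec2: _ => [|i u v _ [<- v0]]; first by rewrite sqrtr1.
by rewrite sqrtrM // mulr_ge0.
Qed.

(** The pairs of vertices on which the two labellings prescribe different edge
    probabilities (when [p] and [q] differ). *)
Definition separated {n : nat} (theta eta : {ffun 'I_n -> bool}) : {pred 'I_n * 'I_n} :=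
  [pred e | (theta e.1 == theta e.2) != (eta e.1 == eta e.2)].

Section Likelihood.
Context {R : realType} {n : nat} (p q : R).
Context (p01 : 0 <= p <= 1) (q01 : 0 <= q <= 1).
Implicit Types (theta eta : {ffun 'I_n -> bool}) (e : vpair n).

Lemma edge_prob_itv theta e : 0 <= edge_prob p q theta e <= 1.
Proof. by rewrite /edge_prob; case: ifP. Qed.

Lemma bernoulli_ge0 theta e (k l : nat) :
  0 <= edge_prob p q theta e ^+ k * (1 - edge_prob p q theta e) ^+ l.
Proof.
by have /andP[u0 u1] := edge_prob_itv theta e;
  rewrite mulr_ge0 ?exprn_ge0 ?subr_ge0.
Qed.

Lemma sbm_pmf_ge0 theta x : 0 <= sbm_pmf p q theta x.
Proof. by apply: prodr_ge0 => e _; exact: bernoulli_ge0. Qed.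

Lemma sum_sbm_pmf theta : \sum_(x : graph n) sbm_pmf p q theta x = 1.
Proof.
rewrite /sbm_pmf (sum_ffun_bool_prod (fun e b => edge_prob p q theta e ^+ nat_of_bool b *
  (1 - edge_prob p q theta e) ^+ (1 - nat_of_bool b)%N)).
by apply: big1 => e _; rewrite /= !expr0 !expr1; ring.
Qed.

Lemma sum_sqrt_sbm_pmf theta eta :
  \sum_(x : graph n) Num.sqrt (sbm_pmf p q theta x * sbm_pmf p q eta x)
  = affinity p q ^+ #|[pred e : vpair n | separated theta eta (val e)]|.
Proof.
pose F e b := Num.sqrt
  ((edge_prob p q theta e ^+ nat_of_bool b *
      (1 - edge_prob p q theta e) ^+ (1 - nat_of_bool b)%N) *
   (edge_prob p q eta e ^+ nat_of_bool b *
      (1 - edge_prob p q eta e) ^+ (1 - nat_of_bool b)%N)).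
rewrite (eq_bigr (fun x : graph n => \prod_e F e (x e))) => [|x _]; last first.
  by rewrite -big_split sqrt_prod // => e; rewrite mulr_ge0 ?bernoulli_ge0.
rewrite sum_ffun_bool_prod -prodr_const [RHS]big_mkcond; apply: eq_bigr => e _.
have /andP[p0 p1] := p01; have /andP[q0 q1] := q01.
have p1' : 0 <= 1 - p by rewrite subr_ge0.
have q1' : 0 <= 1 - q by rewrite subr_ge0.
rewrite /F !expr0 !expr1 !mul1r !mulr1 inE /edge_prob /=; move: (val e) => u.
rewrite /separated /=; case: (_ == _); case: (_ == _) => /=;
  rewrite -?expr2 ?sqrtr_sqr ?ger0_norm //.
- by rewrite addrC subrK.
- by rewrite /affinity mulrC [X in _ + Num.sqrt X]mulrC.
- by rewrite addrC subrK.
Qed.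

(** Writing [u], [v] for the two masses and [S] for the normalisation, [u v / S]
    is at most [sqrt (u v)] because both [u] and [v] are at most [S].  Hence the
    expected posterior mass misplaced on [eta] is bounded by the overlap of the
    two graph laws. *)
Lemma posterior_error_le theta :
  theta \in Theta n ->
  1 - sbm_expectation p q theta (posterior p q [set theta]%SET)
  <= \sum_(eta in Theta n | eta != theta)
       \sum_(x : graph n) Num.sqrt (sbm_pmf p q theta x * sbm_pmf p q eta x).
Proof.
move=> thetaT; rewrite -(sum_sbm_pmf theta) -sumrB exchange_big /=.
apply: ler_sum => x _; rewrite /posterior finset.big_set1.
set u := sbm_pmf p q theta x; set S := \sum_(_ in Theta n) _.
have u0 : 0 <= u by exact: sbm_pmf_ge0.
have leS eta : eta \in Theta n -> sbm_pmf p q eta x <= S.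
  move=> etaT; rewrite /S (bigD1 eta) //= lerDl.
  by apply: sumr_ge0 => *; exact: sbm_pmf_ge0.
have [u_eq0|u_neq0] := eqVneq u 0.
  by rewrite u_eq0 mul0r subr0; apply: sumr_ge0 => *; exact: sqrtr_ge0.
have S0 : 0 < S by rewrite (lt_le_trans _ (leS _ thetaT)) // lt_def u_neq0.
have -> : u - u * (u / S) = \sum_(eta in Theta n | eta != theta) u * sbm_pmf p q eta x / S.
  rewrite -mulr_suml -mulr_sumr.
  have : S = u + \sum_(eta in Theta n | eta != theta) sbm_pmf p q eta x.
    by rewrite /S (bigD1 theta).
  set s := \sum_(_ in Theta n | _) _ => SE.
  have -> : s = S - u by rewrite SE; ring.
  by field; rewrite gt_eqF.
apply: ler_sum => eta /andP[etaT _]; set v := sbm_pmf p q eta x.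
have v0 : 0 <= v by exact: sbm_pmf_ge0.
rewrite ler_pdivrMr // -{1}(sqr_sqrtr (mulr_ge0 u0 v0)) expr2.
rewrite ler_wpM2l ?sqrtr_ge0 // -[leRHS]ger0_norm ?(ltW S0) // -sqrtr_sqr.
by rewrite ler_wsqrtr // expr2 ler_pM // leS.
Qed.

Lemma expected_posterior_le1 theta :
  theta \in Theta n ->
  sbm_expectation p q theta (posterior p q [set theta]%SET) <= 1.
Proof.
move=> thetaT; rewrite -(sum_sbm_pmf theta); apply: ler_sum => x _.
rewrite ler_piMr ?sbm_pmf_ge0 // /posterior finset.big_set1.
set S := \sum_(_ in Theta n) _.
have S0 : 0 <= S by apply: sumr_ge0 => *; exact: sbm_pmf_ge0.
have [->|S_neq0] := eqVneq S 0; first by rewrite invr0 mulr0.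
rewrite ler_pdivrMr ?mul1r ?lt_def ?S_neq0 // /S (bigD1 theta) //= lerDl.
by apply: sumr_ge0 => *; exact: sbm_pmf_ge0.
Qed.

End Likelihood.

(** * Counting labellings by Hamming distance *)

Definition hamming {n : nat} (theta eta : {ffun 'I_n -> bool}) : nat :=
  #|[pred i | theta i != eta i]|.

Definition complement {n : nat} (theta : {ffun 'I_n -> bool}) : {ffun 'I_n -> bool} :=
  [ffun i => ~~ theta i].

Lemma hamming_complement {n : nat} (theta eta : {ffun 'I_n -> bool}) :
  hamming (complement theta) eta = (n - hamming theta eta)%N.
Proof.
have := cardC [pred i | theta i != eta i]; rewrite card_ord.
move=> /(congr1 (subn^~ (hamming theta eta))); rewrite addKn => <-.
apply: eq_card => i; rewrite !inE ffunE.
by case: (theta i); case: (eta i).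
Qed.

Lemma hamming_le {n : nat} (theta eta : {ffun 'I_n -> bool}) :
  (hamming theta eta <= n)%N.
Proof. by rewrite -{2}(card_ord n) max_card. Qed.

(** A pair is separated exactly when one of its endpoints is a vertex where the
    labellings differ and the other is a vertex where they agree. *)
Lemma card_separated {n : nat} (theta eta : {ffun 'I_n -> bool}) :
  #|[pred e : vpair n | separated theta eta (val e)]|
  = (hamming theta eta * (n - hamming theta eta))%N.
Proof.
pose d i := theta i != eta i.
have cE (A : pred 'I_n) : #|A| = (\sum_i A i)%N.
  by rewrite -sum1_card big_mkcond.
rewrite -hamming_complement.
have -> : hamming (complement theta) eta = (\sum_j ~~ d j)%N.
  rewrite /hamming cE; apply: eq_bigr => i _; rewrite /= ffunE /d.
  by case: (theta i); case: (eta i).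
have -> : hamming theta eta = (\sum_i d i)%N by rewrite /hamming cE.
rewrite big_distrlr /=.
have -> : #|[pred e : vpair n | separated theta eta (val e)]| =
   (\sum_(i < n) \sum_(j < n | (i < j)%N) (d i != d j))%N.
  rewrite pair_big_dep /= big_sub -sum1_card big_mkcond /=.
  apply: eq_bigr => e _; rewrite inE /d.
  rewrite /separated /=; case: (val e) => i j /=.
  by case: (theta i); case: (theta j); case: (eta i); case: (eta j).
(* Passing from ordered pairs to pairs [i < j]: each unordered pair collects
   both orders, and the diagonal is empty. *)
have split_pairs (F : 'I_n -> 'I_n -> nat) : (forall i, F i i = 0%N) ->
    (\sum_i \sum_j F i j = \sum_(i < n) \sum_(j < n | (i < j)%N) (F i j + F j i))%N.
  move=> F0; transitivity (\sum_(i < n) \sum_(j < n | (i < j)%N) F i j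
                          + \sum_(i < n) \sum_(j < n | (j < i)%N) F i j)%N.
    rewrite -big_split; apply: eq_bigr => i _ /=.
    rewrite (bigID (fun j : 'I_n => (i < j)%N)) /=; congr addn.
    rewrite (bigD1 i) ?ltnn //= F0 add0n; apply: eq_bigl => j.
    by rewrite -leqNgt -val_eqE /= andbC -ltn_neqAle.
  rewrite [X in (_ + X)%N](exchange_big_dep xpredT) //= -big_split.
  by apply: eq_bigr => i _; rewrite -big_split.
rewrite split_pairs => [|i]; last by case: (d i).
by apply: eq_bigr => i _; apply: eq_bigr => j _; case: (d i); case: (d j).
Qed.

(** The weight of [eta] is the product over vertices of [z] or 1, according to
    whether the labels differ, so the sum over all [eta] factorises. *)
Lemma sum_pow_hamming {R : realType} {n : nat} (z : R)
    (theta : {ffun 'I_n -> bool}) :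
  \sum_eta z ^+ hamming theta eta = (1 + z) ^+ n.
Proof.
pose F i b := if theta i != b then z else 1.
rewrite (eq_bigr (fun eta : {ffun 'I_n -> bool} => \prod_i F i (eta i))).
  rewrite sum_ffun_bool_prod (eq_bigr (fun=> 1 + z)) => [|i _].
    by rewrite prodr_const card_ord.
  by rewrite /F; case: (theta i); rewrite //= addrC.
by move=> eta _; rewrite -prodr_const big_mkcond.
Qed.

Lemma sum_pow_hamming_neq {R : realType} {n : nat} (z : R)
    (theta : {ffun 'I_n -> bool}) :
  \sum_(eta | eta != theta) z ^+ hamming theta eta = (1 + z) ^+ n - 1.
Proof.
rewrite -(sum_pow_hamming z theta) [X in _ = X - 1](bigD1 theta) //=.
have -> : hamming theta theta = 0%N by apply: eq_card0 => i; rewrite !inE eqxx.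
by rewrite expr0 [1 + _]addrC addrK.
Qed.

(** The sizes [m] and [n - m] cannot both be at most [n / 2] unless both equal
    [n / 2]; then the label of vertex 0 is prescribed, and complementing flips
    it. *)
Lemma complement_notin_Theta {n : nat} (theta : {ffun 'I_n -> bool}) :
  (0 < n)%N -> theta \in Theta n -> complement theta \notin Theta n.
Proof.
move=> n_gt0 /finset.bigcupP[m _]; rewrite inE => /andP[/eqP sum_theta anchor].
apply/negP => /finset.bigcupP[m' _]; rewrite inE => /andP[/eqP sum_compl anchor'].
have mm' : (m + m' = n)%N.
  rewrite -sum_theta -sum_compl -big_split /= -[RHS](card_ord n) -sum1_card.
  by apply: eq_bigr => i _; rewrite ffunE; case: (theta i).
have m_half : (m <= n./2)%N by rewrite -ltnS.
have m'_half : (m' <= n./2)%N by rewrite -ltnS.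
have nE := odd_double_half n.
have even : ~~ odd n by apply/negP => odd_n; move: nE; rewrite odd_n; lia.
have mE : m = n./2 :> nat by lia.
have m'E : m' = n./2 :> nat by lia.
move: anchor anchor'; rewrite even mE m'E eqxx /=.
move=> /forallP /(_ (Ordinal n_gt0)) /= t0 /forallP /(_ (Ordinal n_gt0)).
by rewrite ffunE (negbTE t0).
Qed.

(** * Bounds on the affinity *)

Lemma sqrt_le_of_sqr {R : realType} (x y : R) :
  0 <= y -> x <= y ^+ 2 -> Num.sqrt x <= y.
Proof. by move=> y0 xy; rewrite -[leRHS]ger0_norm // -sqrtr_sqr ler_wsqrtr. Qed.

Lemma affinity_le1 {R : realType} (p q : R) :
  0 <= p <= 1 -> 0 <= q <= 1 -> affinity p q <= 1.
Proof.
move=> /andP[p0 p1] /andP[q0 q1].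
have amgm (x y : R) : 0 <= x -> 0 <= y -> Num.sqrt (x * y) <= (x + y) / 2.
  by move=> x0 y0; apply: sqrt_le_of_sqr; [lra | have := sqr_ge0 (x - y); nra].
have := amgm p q p0 q0; have := amgm (1 - p) (1 - q).
by rewrite /affinity !subr_ge0 => /(_ p1 q1); lra.
Qed.

(** Bounding [sqrt (1 - p)] by [1 - p / 2] in each factor separately produces the
    term [p q / 4], which is where the correction [a b ln n / (2 n)] of the phase
    condition comes from. *)
Lemma affinity_le {R : realType} (p q : R) :
  0 <= p <= 1 -> 0 <= q <= 1 ->
  affinity p q <= 1 - (Num.sqrt p - Num.sqrt q) ^+ 2 / 2 + p * q / 4.
Proof.
move=> /andP[p0 p1] /andP[q0 q1].
have sqrt_compl : Num.sqrt ((1 - p) * (1 - q)) <= (1 - p / 2) * (1 - q / 2).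
  apply: sqrt_le_of_sqr; first by apply: mulr_ge0; lra.
  have half (x : R) : 1 - x <= (1 - x / 2) ^+ 2 by have := sqr_ge0 x; nra.
  by rewrite exprMn ler_pM ?subr_ge0.
rewrite /affinity sqrtrM //.
have := sqr_sqrtr p0; have := sqr_sqrtr q0.
move: (Num.sqrt p) (Num.sqrt q) sqrt_compl => u v; nra.
Qed.

(** The larger of [k] and [n - k] is at least [n / 2], and [r ^ (n / 2) <= z];
    squaring avoids the parity of [n].  The sum on the right replaces a case
    distinction on which of the two is larger. *)
Lemma pow_le_pow_add {R : realType} (r z : R) (n k : nat) :
  0 <= r <= 1 -> 0 <= z -> r ^+ n <= z ^+ 2 -> (k <= n)%N ->
  r ^+ (k * (n - k)) <= z ^+ k + z ^+ (n - k).
Proof.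
move=> /andP[r0 r1] z0 rz kn.
have key a b : (n <= b.*2)%N -> r ^+ (a * b) <= z ^+ a.
  move=> nb; rewrite -(@ler_pXn2r _ 2) ?nnegrE ?exprn_ge0 //.
  apply: (@le_trans _ _ (r ^+ (n * a))).
    rewrite -exprM; apply: ler_wiXn2l => //; nia.
  by rewrite exprM -[leRHS]exprM mulnC exprM lerXn2r // nnegrE exprn_ge0.
have [|] := leqP n (n - k).*2 => h.
  by rewrite (le_trans (key k _ h)) // lerDl exprn_ge0.
by rewrite mulnC (le_trans (key (n - k)%N k _)) ?lerDr ?exprn_ge0 //; lia.
Qed.

(** The bound on the affinity reads [1 - (4 ln n + t) / (2 n)], and
    [1 + x <= exp x] turns its [n]-th power into
    [exp (- 2 ln n - t / 2)]. *)
Lemma affinity_pow_le {R : realType} {n : nat} (a b : R) :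
  (0 < n)%N -> 0 <= a -> 0 <= b ->
  let p := a * n%:R^-1 * ln n%:R in let q := b * n%:R^-1 * ln n%:R in
  let t := ((Num.sqrt a - Num.sqrt b) ^+ 2
            - a * b * ln n%:R / (2 * n%:R) - 4) * ln n%:R in
  0 <= p <= 1 -> 0 <= q <= 1 ->
  affinity p q ^+ n <= (expR (- (t / 4)) / n%:R) ^+ 2.
Proof.
move=> n_gt0 a0 b0 p q t p01 q01.
have nR : 0 < n%:R :> R by rewrite ltr0n.
have ln0 : 0 <= ln (n%:R : R) by rewrite ln_ge0 // ler1n.
have -> : (expR (- (t / 4)) / n%:R) ^+ 2 = expR (- ((4 * ln n%:R + t) / (2 * n%:R))) ^+ n.
  rewrite -[n%:R in LHS]lnK ?posrE // -expRN -expRD -!expRM_natl.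
  by congr expR; field; rewrite gt_eqF.
apply: lerXn2r; rewrite ?nnegrE ?expR_ge0 ?addr_ge0 ?sqrtr_ge0 //.
apply: le_trans (expR_ge1Dx _); apply: (le_trans (affinity_le _ _ p01 q01)).
have sqrtE c : 0 <= c ->
    Num.sqrt (c * n%:R^-1 * ln n%:R) = Num.sqrt c * Num.sqrt (n%:R^-1 * ln n%:R).
  by move=> c0; rewrite -mulrA sqrtrM.
rewrite !sqrtE // -mulrBl exprMn sqr_sqrtr; last by rewrite mulr_ge0 ?invr_ge0 ?(ltW nR).
rewrite le_eqVlt; apply/orP; left; apply/eqP; rewrite /t /p /q.
by field; rewrite gt_eqF.
Qed.

(** * Recovery of the communities *)

(** The two sums of [pow_le_pow_add], one centred at [theta] and one at its
    complement, may both be extended to all labellings other than their centre,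
    since neither centre is a competitor in [Theta n]. *)
Lemma recovery_bound {R : realType} {n : nat} (p q z : R)
    (theta : {ffun 'I_n -> bool}) :
  (0 < n)%N -> 0 <= p <= 1 -> 0 <= q <= 1 -> theta \in Theta n ->
  0 <= z -> affinity p q ^+ n <= z ^+ 2 ->
  1 - sbm_expectation p q theta (posterior p q [set theta]%SET)
    <= 2 * ((1 + z) ^+ n - 1).
Proof.
move=> n_gt0 p01 q01 thetaT z0 rz.
have aff01 : 0 <= affinity p q <= 1 by rewrite addr_ge0 ?sqrtr_ge0 ?affinity_le1.
apply: (le_trans (posterior_error_le p q p01 q01 _ thetaT)).
apply: (@le_trans _ _ (\sum_(eta in Theta n | eta != theta)
    (z ^+ hamming theta eta + z ^+ hamming (complement theta) eta))).
  apply: ler_sum => eta _; rewrite sum_sqrt_sbm_pmf // card_separated.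
  by rewrite hamming_complement pow_le_pow_add ?hamming_le.
have sum_sub (P Q : pred {ffun 'I_n -> bool}) (F : {ffun 'I_n -> bool} -> R) :
    (forall eta, 0 <= F eta) -> subpred P Q ->
    \sum_(eta | P eta) F eta <= \sum_(eta | Q eta) F eta.
  move=> F0 PQ; rewrite [leRHS](bigID P) /=.
  rewrite (eq_bigl P) => [|eta]; last by case: (boolP (P eta)) => [/PQ ->|]; rewrite ?andbF.
  by rewrite lerDl sumr_ge0.
rewrite mulr_natl mulr2n big_split -{1}(sum_pow_hamming_neq z theta).
rewrite -(sum_pow_hamming_neq z (complement theta)) /= lerD //; apply: sum_sub.
- by move=> eta; rewrite exprn_ge0.
- by move=> eta /andP[].
- by move=> eta; rewrite exprn_ge0.
- move=> eta /andP[etaT _]; apply: contraTneq etaT => ->.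
  exact: complement_notin_Theta.
Qed.

Theorem corollary4p2 (R : realType) (a b p q : nat -> R)
  (a_ge0 : forall n : nat, (1 <= n)%N -> 0 <= a n)
  (b_ge0 : forall n : nat, (1 <= n)%N -> 0 <= b n)
  (a_O1 : a =O_\oo (fun _ : nat => 1 : R))
  (b_O1 : b =O_\oo (fun _ : nat => 1 : R))
  (pE : forall n : nat, (1 <= n)%N -> p n = a n * n%:R^-1 * ln n%:R)
  (qE : forall n : nat, (1 <= n)%N -> q n = b n * n%:R^-1 * ln n%:R)
  (p01 : forall n : nat, (1 <= n)%N -> 0 <= p n <= 1)
  (q01 : forall n : nat, (1 <= n)%N -> 0 <= q n <= 1)
  (theta : forall n : nat, {ffun 'I_n -> bool})
  (thetaP : forall n : nat, (1 <= n)%N -> theta n \in Theta n)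
  (phase : ((Num.sqrt (a n) - Num.sqrt (b n)) ^+ 2
            - a n * b n * ln n%:R / (2 * n%:R) - 4) * ln n%:R
           @[n --> \oo] --> +oo) :
  sbm_expectation (p n) (q n) (theta n) (posterior (p n) (q n) [set theta n]%SET)
    @[n --> \oo] --> (1 : R).
Proof.
set t := (X in X @ _ --> _) in phase.
pose err n := 2 * (expR (expR (- (t n / 4))) - 1).
have err_cvg0 : err n @[n --> \oo] --> (0 : R).
  have e0 : expR (- (t n / 4)) @[n --> \oo] --> (0 : R).
    apply: (cvg_comp _ (fun x : R => expR (- (x / 4))) phase).
    apply: (cvg_comp (fun x : R => x / 4) (fun x : R => expR (- x))); last exact: cvgr_expR.
    by apply: gt0_cvgMly.
  have ee1 : expR (expR (- (t n / 4))) @[n --> \oo] --> (1 : R).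
    by rewrite -[X in _ --> X]expR0; apply: continuous_cvg => //; exact: continuous_expR.
  rewrite -[X in _ --> X](mulr0 (2 : R)) -(subrr (1 : R)).
  by apply: cvgM; [exact: cvg_cst | apply: cvgB => //; exact: cvg_cst].
apply: (@squeeze_cvgr _ _ _ _ (fun n => 1 - err n) (fun=> 1)).
- near=> n; have n_gt0 : (0 < n)%N by near: n; exact: nbhs_infty_gt.
  have nR : 0 < n%:R :> R by rewrite ltr0n.
  apply/andP; split; last first.
    by apply: expected_posterior_le1; [exact: p01 | exact: q01 | exact: thetaP].
  rewrite lerBlDr -lerBlDl.
  pose z := expR (- (t n / 4)) / n%:R.
  have z0 : 0 <= z by rewrite divr_ge0 ?expR_ge0 ?ltW.
  apply: (@le_trans _ _ (2 * ((1 + z) ^+ n - 1))).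
    apply: recovery_bound => //; [exact: p01 | exact: q01 | exact: thetaP |].
    have := p01 n n_gt0; have := q01 n n_gt0; rewrite pE // qE // => q01n p01n.
    by apply: affinity_pow_le => //; [exact: a_ge0 | exact: b_ge0].
  rewrite ler_wpM2l // lerB //.
  have -> : expR (- (t n / 4)) = n%:R * z by rewrite /z [RHS]mulrC divfK // gt_eqF.
  rewrite expRM_natl lerXn2r ?nnegrE ?expR_ge0 ?addr_ge0 //.
  exact: expR_ge1Dx.
- rewrite -[X in _ --> X](subr0 (1 : R)); apply: cvgB => //; exact: cvg_cst.
- exact: cvg_cst.
Unshelve. all: by end_near.
Qed.
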